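(* There is no computer algorithm that can determine whether the second homotopy group of an arbitrary constructive compact topological space is trivial or not.
   Context: For a compact metric space $(X,d)$ and a given real number $\varepsilon>0$, an $\varepsilon$-net is a discrete subset $N\subseteq X$ such that for every point $x\in X$ there exists a point $y\in N$ with $d(x,y)<\varepsilon$. Finite $\varepsilon$-nets exist for all $\varepsilon>0$ by compactness. The existence of an algorithmically given finite $\varepsilon$-net for any rational $\varepsilon>0$ is used as the definition of a constructive compact topological space. Let $I=[0,1]$, let $I^2=I\times I$ be the unit square, and let $\partial I^2$ be its boundary, i.e. the set of $(s_1,s_2)\in I^2$ with some $s_i\in\{0,1\}$. For a topological space $X$ and $x_0\in X$, a 2-sphere at $x_0$ is a continuous map $\alpha:I^2\to X$ that maps $\partial I^2$ to the point $x_0$. Two 2-spheres $\alpha,\beta$ at $x_0$ are homotopic if there is a continuous map $F:I^2\times I\to X$ with $F(s_1,s_2,0)=\alpha(s_1,s_2)$, $F(s_1,s_2,1)=\beta(s_1,s_2)$, and $F(s_1,s_2,t)=x_0$ for all $(s_1,s_2)\in\partial I^2$ and $t\in I$. The second homotopy group $\pi_2(X,x_0)$ at $x_0$ is the set of homotopy classes $[\alpha]$ of 2-spheres at $x_0$, with product $[\alpha]\ast[\beta]=[\alpha\cdot\beta]$, where $(\alpha\cdot\beta)(s_1,s_2)=\alpha(2s_1,s_2)$ for $s_1\in[0,\tfrac12]$ and $(\alpha\cdot\beta)(s_1,s_2)=\beta(2s_1-1,s_2)$ for $s_1\in[\tfrac12,1]$. A group is trivial if it consists only of its identity element. *)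

(* Defs.v *)
From Stdlib Require Cantor.
From mathcomp Require Import all_boot all_order all_algebra.
From mathcomp Require Import all_classical all_reals all_analysis.
Set Implicit Arguments.
Unset Strict Implicit.
Unset Printing Implicit Defensive.
Import Order.TTheory GRing.Theory Num.Theory.
Import numFieldNormedType.Exports.
Local Open Scope classical_set_scope.
Local Open Scope ring_scope.

Definition npair (m n : nat) : nat := Cantor.to_nat (m, n).
Definition unpair (n : nat) : nat * nat := Cantor.of_nat n.

(* Programs for the partial recursive functions.  All functions are unary;
   several arguments are passed through [npair]. *)
Inductive program : Type :=
| Zero
| Succ
| Fst
| Snd
| Pair of program & program
| Comp of program & program
| Prec of program & program
| Mu of program.

(* [computes p x y]: the program [p] halts on input [x] with output [y].
   - [Prec f g] maps [npair a 0] to [f a], and [npair a m.+1] to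
     [g (npair a (npair m z))], where [z] is its value at [npair a m];
   - [Mu f] maps [x] to the least [y] such that [f (npair x y) = 0], provided
     that [f] halts on all the preceding arguments. *)
Fixpoint computes (p : program) (x y : nat) {struct p} : Prop :=
  match p with
  | Zero => y = 0%N
  | Succ => y = x.+1
  | Fst => y = (unpair x).1
  | Snd => y = (unpair x).2
  | Pair f g =>
      exists u v : nat, [/\ computes f x u, computes g x v & y = npair u v]
  | Comp f g => exists2 z : nat, computes g x z & computes f z y
  | Prec f g =>
      let a := (unpair x).1 in
      (fix prec (n r : nat) {struct n} : Prop :=
         match n with
         | 0%N => computes f a r
         | m.+1 =>
             exists2 z : nat, prec m z & computes g (npair a (npair m z)) r
         end) (unpair x).2 y
  | Mu f =>
      computes f (npair x y) 0%N /\
      forall m : nat, (m < y)%N ->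
        exists z : nat, computes f (npair x m) z.+1
  end.

Fixpoint godel (p : program) : nat :=
  match p with
  | Zero => npair 0 0
  | Succ => npair 1 0
  | Fst => npair 2 0
  | Snd => npair 3 0
  | Pair f g => npair 4 (npair (godel f) (godel g))
  | Comp f g => npair 5 (npair (godel f) (godel g))
  | Prec f g => npair 6 (npair (godel f) (godel g))
  | Mu f => npair 7 (godel f)
  end.

Fixpoint code_seq (s : seq nat) : nat :=
  match s with
  | [::] => 0%N
  | n :: s' => (npair n (code_seq s')).+1
  end.

(* Every nonnegative rational number has a code (in fact, several). *)
Definition decode_rat (n : nat) : rat :=
  (unpair n).1%:R / (unpair n).2.+1%:R.

(* [N `<=` isolated N] says that the subset [N] is discrete. *)
Definition eps_net (R : realType) (X : metricType R) (eps : R) (N : set X) :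
    Prop :=
  N `<=` isolated N /\ forall x : X, exists2 y : X, N y & mdist x y < eps.

(* The algorithms handle the points of [X] through a system of names
   [pt : nat -> X]: [dist] approximates the distance between two named points
   up to any rational [eps > 0], and [net] lists the names of the points of a
   finite [eps]-net.  The named points are thus dense, so that the compact space
   [X] is determined by [dist] up to isometry. *)
Definition constructive_compact (R : realType) (X : metricType R)
    (pt : nat -> X) (dist net : program) : Prop :=
  [/\ compact [set: X],
      forall i j e : nat, 0 < decode_rat e ->
        exists2 q : nat, computes dist (npair (npair i j) e) q &
          `|mdist (pt i) (pt j) - ratr (decode_rat q)| < ratr (decode_rat e)
    & forall e : nat, 0 < decode_rat e ->
        exists2 s : seq nat, computes net e (code_seq s) &
          eps_net (ratr (decode_rat e)) (pt @` [set` s])].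

(* Maps defined on the square or on the cube are represented by total functions
   whose values outside of the square or the cube are irrelevant. *)

Definition square (R : realType) : set (R * R) := `[0, 1] `*` `[0, 1].

Definition square_boundary (R : realType) : set (R * R) :=
  [set s | square s /\ [\/ s.1 = 0, s.1 = 1, s.2 = 0 | s.2 = 1]].

Section SecondHomotopyGroup.
Variables (R : realType) (X : topologicalType) (x0 : X).

Definition sphere2 : set (R * R -> X) :=
  [set f | {within @square R, continuous f} /\
           forall s, square_boundary s -> f s = x0].

Definition homotopic2 (f g : R * R -> X) : Prop :=
  exists F : (R * R) * R -> X,
    [/\ {within @square R `*` `[0, 1], continuous F},
        forall s, square s -> F (s, 0) = f s,
        forall s, square s -> F (s, 1) = g s
      & forall s t, square_boundary s -> 0 <= t <= 1 -> F (s, t) = x0].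

Definition homotopy_class2 (f : R * R -> X) : set (R * R -> X) :=
  [set g | sphere2 g /\ homotopic2 f g].

Definition concat2 (f g : R * R -> X) (s : R * R) : X :=
  if s.1 <= 2^-1 then f (2 * s.1, s.2) else g (2 * s.1 - 1, s.2).

Definition pi2 : set (set (R * R -> X)) :=
  [set homotopy_class2 f | f in sphere2].

(* The product is defined on classes without choosing representatives: it is
   the union of the classes of all the [concat2 f g], which coincide. *)
Definition pi2_mul (A B : set (R * R -> X)) : set (R * R -> X) :=
  \bigcup_(f in A) \bigcup_(g in B) homotopy_class2 (concat2 f g).

Definition pi2_identity (e : set (R * R -> X)) : Prop :=
  pi2 e /\ forall A, pi2 A -> pi2_mul e A = A /\ pi2_mul A e = A.

Definition pi2_trivial : Prop := exists2 e, pi2_identity e & pi2 = [set e].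

End SecondHomotopyGroup.

Arguments pi2_trivial R {X} x0.

(* Main.v *)
Require Import Defs.
From Stdlib Require Cantor.
From HB Require Import structures.
From mathcomp Require Import all_boot all_order all_algebra.
From mathcomp Require Import all_classical all_reals all_analysis.
From mathcomp Require Import zify ring lra.

(** A sphere can shrink to a point without any measurement of bounded precision
    noticing it, and a supposed decision procedure can be turned against itself
    by a sphere whose radius watches the procedure.

    For a decidable property [h] of natural numbers let [r] be [1 / n.+1] when [n]
    is the least number with [h n], and [0] when there is none.  Let [X] be a
      sphere
    of size [r] in 3-space, that is a single point for [r = 0].  Distances in [X]
    can be approximated up to [eps] after testing [h] on the numbers below [2 /
      eps]
    only ([approx_distP]), and a net for the sphere of size [1] is also a net for
    all the smaller ones ([net_bubble]), so [X] is a constructive compact space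
    uniformly in a program for [h].  Its [pi2] is trivial iff [h] never holds.

    Given a decision procedure [D], let [h n] say that [D], run with its searches
    bounded by [n], answers that [X] is trivial.  Bounded runs of the fixed
      program
    [D] are computable ([computable_fuel_eval]), and the reference to the code of
    the space that is being defined is resolved by the s-m-n construction
    applied to a program and its own code ([computable_godel_specialize]).  If [h]
    holds somewhere, [D] has called trivial a space with an essential sphere.
    If [h] never holds, [X] is a point, and [D] fails to say so.

    The remaining point is that the parametrization of the sphere by the square
    is not null-homotopic ([sphere_essential]).  A homotopy [F] would map the cube
    to [X], with a constant value on all its faces but the bottom one.  Label the
    vertices of a grid by the signs [a], [b], [c] of the three coordinates of [F]
    relative to a point enclosed by the sphere.  The cubical cup product of
    the differentials [da], [db], [dc] is the coboundary of the product of [a],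
    [db] and [dc], so its sum over the grid telescopes to the boundary
    ([cup3_stokes]).  There [a] vanishes except on the bottom face, where the sum
    is evaluated by the same argument one dimension below.  It is not zero,
      so some
    cube of the grid carries sign changes of all three coordinates
    ([trichromatic_cube]).  This holds for every mesh,
      although [F] stays away from
    the enclosed point. *)

Set Implicit Arguments.
Unset Strict Implicit.
Unset Printing Implicit Defensive.
Import Order.TTheory GRing.Theory Num.Theory.
Import numFieldNormedType.Exports.

(** * Computable functions *)

Lemma npairK m n : unpair (npair m n) = (m, n).
Proof. exact: Cantor.cancel_of_to. Qed.

Lemma unpairK n : npair (unpair n).1 (unpair n).2 = n.
Proof. by rewrite /npair -surjective_pairing; exact: Cantor.cancel_to_of. Qed.

Arguments npair : simpl never.
Arguments unpair : simpl never.

Definition computable (f : nat -> nat) : Prop :=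
  exists p : program, forall x, computes p x (f x).

(** Functions of several arguments are computed through the same pairing as
    the arguments of [Prec] and [Mu]. *)
Definition computable2 (f : nat -> nat -> nat) : Prop :=
  computable (fun x => f (unpair x).1 (unpair x).2).

Definition computable3 (f : nat -> nat -> nat -> nat) : Prop :=
  computable
    (fun x => f (unpair x).1 (unpair (unpair x).2).1 (unpair (unpair x).2).2).

Lemma eq_computable f g : f =1 g -> computable f -> computable g.
Proof. by move=> fg [p pf]; exists p => x; rewrite -fg. Qed.

Lemma computable_comp f g : computable f -> computable g ->
  computable (fun x => f (g x)).
Proof. by move=> [p pf] [q qg]; exists (Comp p q) => x /=; exists (g x). Qed.

Lemma computable_npair f g : computable f -> computable g ->
  computable (fun x => npair (f x) (g x)).
Proof.
by move=> [p pf] [q qg]; exists (Pair p q) => x /=; exists (f x), (g x).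
Qed.

Lemma computable_fst f : computable f -> computable (fun x => (unpair (f x)).1).
Proof. by apply: (@computable_comp (fun x => (unpair x).1)); exists Fst. Qed.

Lemma computable_snd f : computable f -> computable (fun x => (unpair (f x)).2).
Proof. by apply: (@computable_comp (fun x => (unpair x).2)); exists Snd. Qed.

Lemma computable_succ f : computable f -> computable (fun x => (f x).+1).
Proof. by apply: computable_comp; exists Succ. Qed.

Definition id_prog : program := Pair Fst Snd.

Lemma computes_id x : computes id_prog x x.
Proof.
by exists (unpair x).1, (unpair x).2; split => //=; rewrite unpairK.
Qed.

Lemma computable_id : computable (fun x => x).
Proof. exists id_prog; exact: computes_id. Qed.

Definition const_prog (n : nat) : program := iter n (Comp Succ) Zero.

Lemma computes_const n x : computes (const_prog n) x n.
Proof. by elim: n => [//|n IH] /=; exists n. Qed.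

Lemma computable_const n : computable (fun=> n).
Proof. exists (const_prog n) => x; exact: computes_const. Qed.

#[local] Hint Resolve computable_const computable_id computable_npair
  computable_fst computable_snd computable_succ : computable.

Lemma computable_app2 h f g : computable2 h -> computable f -> computable g ->
  computable (fun x => h (f x) (g x)).
Proof.
move=> ch cf cg; have := computable_comp ch (computable_npair cf cg).
by apply: eq_computable => x; rewrite npairK.
Qed.

(** The form of primitive recursion that all the later functions reduce to: the
    number of steps, the initial value and the step may depend on [x]. *)
Lemma computable_nat_rect f g n :
  computable f -> computable3 g -> computable n ->
  computable (fun x => nat_rect (fun=> nat) (f x) (g x) (n x)).
Proof.
move=> [p pf] [q qg] cn.
suff : computable2 (fun x k => nat_rect (fun=> nat) (f x) (g x) k).
  by move=> /computable_app2; apply; first exact: computable_id.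
exists (Prec p q) => x /=; elim: (unpair x).2 => [|k IH] //=.
eexists; first exact: IH.
by have := qg (npair (unpair x).1 (npair k (nat_rect (fun=> nat)
  (f (unpair x).1) (g (unpair x).1) k))); rewrite !npairK.
Qed.

Lemma computable_case f g n :
  computable f -> computable2 g -> computable n ->
  computable (fun x => if n x is m.+1 then g x m else f x).
Proof.
move=> cf cg cn.
have cg3 : computable3 (fun x m _ => g x m).
  by apply: (computable_app2 (h := g)); auto with computable.
by apply: eq_computable (computable_nat_rect cf cg3 cn) => x; case: (n x).
Qed.

Lemma computable_addn f g : computable f -> computable g ->
  computable (fun x => f x + g x).
Proof.
move=> cf cg.
have cS : computable3 (fun _ _ z => z.+1) by red; auto with computable.
by apply: eq_computable (computable_nat_rect cg cS cf) => x;
  elim: (f x) => //= n ->.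
Qed.

Lemma computable_muln f g : computable f -> computable g ->
  computable (fun x => f x * g x).
Proof.
move=> cf cg.
have cS : computable3 (fun x _ z => g x + z).
  by apply: computable_addn; [apply: computable_comp cg _|]; auto with computable.
apply: eq_computable (computable_nat_rect (computable_const 0) cS cf) => x.
by elim: (f x) => //= n ->; rewrite mulSn.
Qed.

Lemma computable_predn f : computable f -> computable (fun x => (f x).-1).
Proof.
move=> cf; have c1 : computable2 (fun x m => m) by red; auto with computable.
by apply: eq_computable (computable_case (computable_const 0) c1 cf) => x;
  case: (f x).
Qed.

Lemma computable_subn f g : computable f -> computable g ->
  computable (fun x => f x - g x).
Proof.
move=> cf cg.
have cS : computable3 (fun _ _ z => z.-1).
  by apply: computable_predn; auto with computable.
apply: eq_computable (computable_nat_rect cf cS cg) => x.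
by elim: (g x) => /= [|n ->]; rewrite ?subn0 ?subnS.
Qed.

Lemma computable_minn f g : computable f -> computable g ->
  computable (fun x => minn (f x) (g x)).
Proof.
move=> cf cg.
apply: eq_computable (computable_subn cf (computable_subn cf cg)) => x.
by rewrite minnE.
Qed.

Lemma computable_maxn f g : computable f -> computable g ->
  computable (fun x => maxn (f x) (g x)).
Proof.
move=> cf cg.
apply: eq_computable (computable_addn cf (computable_subn cg cf)) => x.
by rewrite maxnE.
Qed.

#[local] Hint Resolve computable_addn computable_muln computable_predn
  computable_subn computable_minn computable_maxn : computable.

(** * Running a program with bounded searches *)

(** In this part a natural number encodes an optional result: [0] is a failure
    and [y.+1] is the value [y], so that partial runs are again functions from
    [nat] to [nat]. *)
Definition bind (u : nat) (f : nat -> nat) : nat := if u is y.+1 then f y else 0.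

(** The state of a search is [0] while it goes on, [1] when it met a failure and
    [m.+2] when it stopped at [m]; the predecessor of the final state is thus an
    optional result. *)
Definition search_step (v : nat -> nat) (m st : nat) : nat :=
  if st is _.+1 then st
  else if v m is v'.+1 then if v' is _.+1 then 0 else m.+2 else 1.

Definition search (v : nat -> nat) (n : nat) : nat :=
  (nat_rect (fun=> nat) 0 (search_step v) n).-1.

(** Only unbounded search can diverge, so it suffices to let [n] bound the
    searches: this makes [fuel_eval p] total, and computable by a program built
    by recursion on [p], with no universal machine. *)
Fixpoint fuel_eval (p : program) (n x : nat) : nat :=
  match p with
  | Zero => 1
  | Succ => x.+2
  | Fst => (unpair x).1.+1
  | Snd => (unpair x).2.+1
  | Pair f g =>
      bind (fuel_eval f n x) (fun u =>
        bind (fuel_eval g n x) (fun v => (npair u v).+1))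
  | Comp f g => bind (fuel_eval g n x) (fuel_eval f n)
  | Prec f g =>
      let a := (unpair x).1 in
      nat_rect (fun=> nat) (fuel_eval f n a)
        (fun m u => bind u (fun z => fuel_eval g n (npair a (npair m z))))
          (unpair x).2
  | Mu f => search (fun m => fuel_eval f n (npair x m)) n
  end.

Lemma search_succ v n k : search v n = k.+1 <->
  [/\ (k < n)%N, v k = 1 & forall m, (m < k)%N -> exists z, v m = z.+2].
Proof.
rewrite /search; set st := nat_rect _ _ _.
have st0 m : st m = 0 <-> forall i, (i < m)%N -> exists z, v i = z.+2.
  elim: m => [|m [IH1 IH2]] //=; split.
    rewrite /search_step; case E: (st m) => [|s] //.
    case Ev: (v m) => [|[|z]] // _ i; rewrite ltnS leq_eqVlt => /orP[/eqP->|].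
      by exists z.
    exact: IH1.
  move=> H; rewrite /search_step IH2; last by move=> i im; apply: H; lia.
  by have [z ->] := H m (ltnSn m).
have stk m : (st m).-1 = k.+1 ->
    [/\ (k < m)%N, v k = 1 & forall i, (i < k)%N -> exists z, v i = z.+2].
  elim: m => [|m IH] //=; rewrite {1}/search_step; case E: (st m) => [|s].
    case Ev: (v m) => [|[|z]] //= [<-]; split => //; exact/st0.
  by rewrite -E => /IH[? ? ?]; split => //; lia.
split; first exact: stk.
move=> [kn vk km]; elim: n kn => [|n IH] //; rewrite ltnS leq_eqVlt =>
  /orP[/eqP<-|].
  by rewrite /= (st0 k).2 //= vk.
by move=> /IH /=; case: (st n) => //= s ->.
Qed.

Lemma bind_succ u f y : bind u f = y.+1 <-> exists2 z, u = z.+1 & f z = y.+1.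
Proof.
split; first by case: u => // z /= fz; exists z.
by move=> [z -> /=].
Qed.

Lemma fuel_eval_mono p n n' x y : (n <= n')%N -> fuel_eval p n x = y.+1 ->
  fuel_eval p n' x = y.+1.
Proof.
move=> nn'; elim: p x y => //= [f IHf g IHg|f IHf g IHg|f IHf g IHg|f IHf] x y.
- move=> /bind_succ[u /IHf-> /=] /bind_succ[v /IHg-> /=]; exact: id.
- by move=> /bind_succ[z /IHg-> /= /IHf].
- elim: (unpair x).2 y => [|m IH] y /=; first exact: IHf.
  by move=> /bind_succ[z /IH-> /= /IHg].
- move=> /search_succ[yn fy fm]; apply/search_succ; split.
  + lia.
  + exact: IHf.
  + by move=> m /fm[z /IHf]; exists z.
Qed.

(** The finitely many subcomputations of a halting computation succeed with
    a common bound, by monotonicity. *)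
Lemma fuel_eval_complete p x y : computes p x y ->
  exists n, fuel_eval p n x = y.+1.
Proof.
elim: p x y => /= [| | | |f IHf g IHg|f IHf g IHg|f IHf g IHg|f IHf] x y.
1-4: by move=> ->; exists 0.
- move=> [u [v [/IHf[n nu] /IHg[m mv] ->]]]; exists (maxn n m).
  rewrite (fuel_eval_mono (leq_maxl n m) nu).
  by rewrite (fuel_eval_mono (leq_maxr n m) mv).
- move=> [z /IHg[n nz] /IHf[m my]]; exists (maxn n m).
  rewrite (fuel_eval_mono (leq_maxl n m) nz) /=.
  exact: fuel_eval_mono (leq_maxr n m) my.
- have E n : nat_rect (fun=> nat) (fuel_eval f n (unpair x).1)
        (fun m u => bind u (fun z =>
           fuel_eval g n (npair (unpair x).1 (npair m z)))) (unpair x).2 =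
      fuel_eval (Prec f g) n (npair (unpair x).1 (unpair x).2).
    by rewrite /= npairK.
  under eq_exists do rewrite E.
  elim: (unpair x).2 y => [|k IH] y.
    by move=> /IHf [n ny]; exists n; rewrite /= npairK.
  move=> [z /IH[n nz] /IHg[m my]]; exists (maxn n m).
  move/(fuel_eval_mono (leq_maxl n m)): nz; rewrite /= !npairK /= => -> /=.
  exact: fuel_eval_mono (leq_maxr n m) my.
- move=> [/IHf[n ny] H].
  have [N HN] : exists N, forall m, (m < y)%N ->
      exists z, fuel_eval f N (npair x m) = z.+2.
    have {}H m : (m < y)%N -> exists N z, fuel_eval f N (npair x m) = z.+2.
      by move=> /H[z /IHf[N ?]]; exists N, z.
    elim: y H {ny} => [|y IH] H; first by exists 0.
    have [|N HN] := IH; first by move=> m my; apply: H; lia.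
    have [N' [z Hz]] := H y (ltnSn y).
    exists (maxn N N') => m; rewrite ltnS leq_eqVlt => /orP[/eqP->|/HN[z' Hz']].
      by exists z; apply: fuel_eval_mono Hz; lia.
    by exists z'; apply: fuel_eval_mono Hz'; lia.
  exists (y.+1 + maxn n N); apply/search_succ; split.
  + lia.
  + by apply: fuel_eval_mono ny; lia.
  + by move=> m /HN[z Hz]; exists z; apply: fuel_eval_mono Hz; lia.
Qed.

Lemma computable_bind u f : computable u -> computable2 f ->
  computable (fun x => bind (u x) (f x)).
Proof. by move=> cu cf; exact: computable_case (computable_const 0) cf cu. Qed.

Lemma computable_search v n : computable2 v -> computable n ->
  computable (fun x => search (v x) (n x)).
Proof.
move=> cv cn; apply: computable_predn.
apply: computable_nat_rect => //; first exact: computable_const.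
rewrite /computable3 /search_step.
pose st x := (unpair (unpair x).2).2.
have cst : computable st by unfold st; auto with computable.
suff : computable (fun x => if st x is _.+1 then st x else
   if v (unpair x).1 (unpair (unpair x).2).1 is v'.+1
   then if v' is _.+1 then 0 else (unpair (unpair x).2).1.+2 else 1).
  by move=> H; apply: eq_computable H => x; rewrite /st;
    case: (unpair (unpair x).2).2.
apply: (@computable_case _ (fun x _ => st x) st) => //.
  apply: (@computable_case _
     (fun x v' => if v' is _.+1 then 0 else (unpair (unpair x).2).1.+2)
     (fun x => v (unpair x).1 (unpair (unpair x).2).1)).
  - by auto with computable.
  - apply: (@computable_case _ (fun _ _ => 0)); auto 8 with computable.
    by red; auto with computable.
  - by apply: computable_app2 => //; auto with computable.
by apply: (computable_comp cst); auto with computable.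
Qed.

(** Each clause of [fuel_eval] is a closure property of computable functions. *)
Lemma computable_fuel_eval p : computable2 (fuel_eval p).
Proof.
elim: p => [| | | |f IHf g IHg|f IHf g IHg|f IHf g IHg|f IHf];
  rewrite /computable2 /=.
1-4: by auto with computable.
- apply: computable_bind => //; apply: (computable_bind (f :=
  fun x v => (npair (unpair x).2 v).+1)).
    by apply: (computable_app2 IHg); auto 8 with computable.
  by red; auto 8 with computable.
- apply: computable_bind => //.
  by apply: (computable_app2 IHf); auto with computable.
- apply: computable_nat_rect; last by auto with computable.
    by apply: (computable_app2 IHf); auto with computable.
  apply: (computable_bind (f := fun x z => fuel_eval g (unpair (unpair x).1).1
    (npair (unpair (unpair (unpair x).1).2).1 (npair (unpair (unpair x).2).1
      z)))).
    by auto with computable.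
  by apply: (computable_app2 IHg); auto 12 with computable.
- apply: computable_search; last by auto with computable.
  by apply: (computable_app2 IHf); auto 12 with computable.
Qed.

(** * Lebesgue numbers *)

Section Lebesgue.
Local Open Scope classical_set_scope.
Local Open Scope ring_scope.

(** Around [x] the set [S i] contains a ball of some radius [e]; then the points
    within [e / 2] of [x] share the index [i] for all radii below [e / 2], and
    compactness makes such a radius uniform. *)
Lemma lebesgue_number (R : realType) (T : pseudoMetricType R) (I : Type)
    (K : set T) (S : I -> set T) :
  compact K ->
  (forall x, K x -> exists i, \forall y \near x, K y -> S i y) ->
  exists2 d : R, 0 < d & forall x, K x -> exists i, K `&` ball x d `<=` S i.
Proof.
move=> /compact_near_coveringP cK cov.
have := cK R 0^'+ (fun d x => exists i, K `&` ball x d `<=` S i) _.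
case.
  move=> x /cov[i] /nbhs_ballP[e /= e0 xe].
  exists (ball x (e / 2), [set d | d < e / 2]); first split => /=.
  - by apply: nbhsx_ballx; rewrite divr_gt0.
  - by apply: nbhs_right_lt; rewrite divr_gt0.
  move=> [x' d] /= [xx' de]; exists i => y [Ky x'y]; apply: xe => //.
  rewrite (splitr e); apply: ball_triangle xx' _.
  exact: le_ball (ltW de) _ x'y.
move=> e /= e0 H; exists (e / 2); first by rewrite divr_gt0.
move=> x Kx; apply: (H (e / 2)) => //=; last by rewrite divr_gt0.
by rewrite sub0r normrN gtr0_norm ?divr_gt0 // ltr_pdivrMr // ltr_pMr // ltr1n.
Qed.
End Lebesgue.

(** * Cup products of labels on a cubical grid *)

Section Stokes.
Local Open Scope ring_scope.
Variable A : comPzRingType.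

Section Square.
Variables b c : nat -> nat -> A.

(** [cup2 i j] is the value of the cubical cup product of the cochains [db] and
    [dc] on the square with lower corner [(i, j)]: its two terms are the two
    monotone edge paths from that corner to the opposite one. *)
Definition cup2 (i j : nat) : A :=
  (b i.+1 j - b i j) * (c i.+1 j.+1 - c i.+1 j)
  - (b i j.+1 - b i j) * (c i.+1 j.+1 - c i j.+1).

(** The product of [db] and [dc] is the coboundary of the product of [b] and
    [dc]: both sums on the right telescope. *)
Lemma cup2_stokes m n p q : (m <= n)%N -> (p <= q)%N ->
  \sum_(m <= i < n) \sum_(p <= j < q) cup2 i j =
  \sum_(p <= j < q) (b n j * (c n j.+1 - c n j) - b m j * (c m j.+1 - c m j))
  - \sum_(m <= i < n) (b i q * (c i.+1 q - c i q) - b i p * (c i.+1 p - c i p)).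
Proof.
move=> mn pq.
have E i j : cup2 i j =
    (b i.+1 j * (c i.+1 j.+1 - c i.+1 j) - b i j * (c i j.+1 - c i j))
  - (b i j.+1 * (c i.+1 j.+1 - c i j.+1) - b i j * (c i.+1 j - c i j)).
  by rewrite /cup2; ring.
under eq_bigr do under eq_bigr do rewrite E.
under eq_bigr do rewrite sumrB.
rewrite sumrB; congr (_ - _); last first.
  by apply: eq_bigr => i _; rewrite telescope_sumr.
rewrite exchange_big /=; apply: eq_bigr => j _.
by rewrite (telescope_sumr (fun i => b i j * (c i j.+1 - c i j))).
Qed.
End Square.

Variables a b c : nat -> nat -> nat -> A.

(** The values of the 2-cochain [a] times [db] times [dc] on the squares that are
    orthogonal to the third, second and first axis. *)
Definition face12 k i j :=
  a i j k * cup2 (fun i j => b i j k) (fun i j => c i j k) i j.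
Definition face13 j i k :=
  a i j k * cup2 (fun i k => b i j k) (fun i k => c i j k) i k.
Definition face23 i j k := a i j k * cup2 (b i) (c i) j k.

(** The coboundary of that 2-cochain, so that sums of [cup3] telescope by
    definition. *)
Definition cup3 i j k : A :=
  (face12 k.+1 i j - face12 k i j) - (face13 j.+1 i k - face13 j i k)
  + (face23 i.+1 j k - face23 i j k).

(** The same number as the cup product of [da], [db] and [dc]: since [db] times
    [dc] is closed, only [a] gets differentiated.  In this form [cup3] visibly
    vanishes on a cube where one of the labels is constant. *)
Lemma cup3E i j k : cup3 i j k =
  (a i.+1 j k - a i j k) * cup2 (b i.+1) (c i.+1) j k
  - (a i j.+1 k - a i j k) *
      cup2 (fun i k => b i j.+1 k) (fun i k => c i j.+1 k) i k
  + (a i j k.+1 - a i j k) *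
      cup2 (fun i j => b i j k.+1) (fun i j => c i j k.+1) i j.
Proof. rewrite /cup3 /face12 /face13 /face23 /cup2. ring. Qed.

Lemma cup3_stokes n :
  \sum_(0 <= k < n) \sum_(0 <= i < n) \sum_(0 <= j < n) cup3 i j k =
  (\sum_(0 <= i < n) \sum_(0 <= j < n) (face12 n i j - face12 0 i j))
  - (\sum_(0 <= k < n) \sum_(0 <= i < n) (face13 n i k - face13 0 i k))
  + (\sum_(0 <= k < n) \sum_(0 <= j < n) (face23 n j k - face23 0 j k)).
Proof.
under eq_bigr do under eq_bigr do rewrite big_split sumrB /=.
under eq_bigr do rewrite big_split sumrB /=.
rewrite big_split sumrB /=; congr (_ - _ + _).
- rewrite exchange_big /=; apply: eq_bigr => i _.
  rewrite exchange_big /=; apply: eq_bigr => j _.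
  by rewrite (telescope_sumr (fun k => face12 k i j)).
- apply: eq_bigr => k _; apply: eq_bigr => i _.
  by rewrite (telescope_sumr (fun j => face13 j i k)).
- apply: eq_bigr => k _; rewrite exchange_big /=; apply: eq_bigr => j _.
  by rewrite (telescope_sumr (fun i => face23 i j k)).
Qed.
End Stokes.

Definition constant_on_cube (h : nat -> nat -> nat -> bool) (i j k : nat) :=
  forall x y z : bool, h (x + i)%N (y + j)%N (z + k)%N = h i j k.

Section Cube.
Local Open Scope ring_scope.
(** If no cube were trichromatic then [cup3] would vanish everywhere.  But its sum
    over the grid is a sum over the boundary of terms with a factor [a], hence,
    up to sign, the sum of [cup2 b c] over the square [[p, q]^2] of the bottom
    face.  That sum equals [1] by [cup2_stokes]: [c] is constant on the
    two sides where [b] varies freely, and along the side where [b] is [1] the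
    label [c] increases from [0] to [1]. *)
Lemma trichromatic_cube (a b c : nat -> nat -> nat -> bool) (n p q : nat) :
  (p < q <= n)%N ->
  (forall j k, a 0%N j k = false) -> (forall j k, a n j k = false) ->
  (forall i k, a i 0%N k = false) -> (forall i k, a i n k = false) ->
  (forall i j, a i j n = false) ->
  (forall i j, (i < n)%N -> (j < n)%N -> a i j 0%N =
    (p <= i < q)%N && (p <= j < q)%N) ->
  (forall j, (p <= j <= q)%N -> b p j 0%N = false /\ b q j 0%N) ->
  (forall i, (p <= i <= q)%N -> c i p 0%N = false /\ c i q 0%N) ->
  exists i j k, [/\ (i < n)%N, (j < n)%N & (k < n)%N] /\
    [/\ ~ constant_on_cube a i j k, ~ constant_on_cube b i j k
     & ~ constant_on_cube c i j k].
Proof.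
move=> /andP[pq qn] a0x anx ax0 axn axxn abot bb cc.
pose z (h : nat -> nat -> nat -> bool) i j k : int := (h i j k)%:R.
apply: contrapT => H.
have cup0 i j k : (i < n)%N -> (j < n)%N -> (k < n)%N ->
  cup3 (z a) (z b) (z c) i j k = 0.
  move=> ni nj nk.
  have : constant_on_cube a i j k \/ constant_on_cube b i j k \/
    constant_on_cube c i j k.
    apply: contrapT => /not_orP[? /not_orP[? ?]]; apply: H.
    by exists i, j, k.
  rewrite cup3E /cup2 /z => -[E|[E|E]].
  - move: (E true false false) (E false true false) (E false false true).
    by rewrite !add0n !add1n => -> -> ->; rewrite !subrr !mul0r subr0 addr0.
  - move: (E true false false) (E false true false) (E false false true)
      (E true true false) (E false true true) (E true false true)
      (E true true true).
    rewrite !add0n !add1n => e1 e2 e3 e4 e5 e6 e7.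
    rewrite ?e1 ?e2 ?e3 ?e4 ?e5 ?e6 ?e7.
    by rewrite !subrr ?(mul0r, mulr0, subr0, addr0).
  - move: (E true false false) (E false true false) (E false false true)
      (E true true false) (E false true true) (E true false true)
      (E true true true).
    rewrite !add0n !add1n => e1 e2 e3 e4 e5 e6 e7.
    rewrite ?e1 ?e2 ?e3 ?e4 ?e5 ?e6 ?e7.
    by rewrite !subrr ?(mul0r, mulr0, subr0, addr0).
have := cup3_stokes (z a) (z b) (z c) n.
rewrite big_nat big1; last first.
  move=> k nk; rewrite big_nat big1 // => i ni; rewrite big_nat big1 // => j nj.
  exact: cup0.
have za0 i j k : a i j k = false -> z a i j k = 0 by rewrite /z => ->.
under [X in _ - X + _]eq_bigr do under eq_bigr do
  rewrite /face13 (za0 _ _ _ (ax0 _ _)) (za0 _ _ _ (axn _ _)) !mul0r subr0.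
under [X in _ - _ + X]eq_bigr do under eq_bigr do
  rewrite /face23 (za0 _ _ _ (a0x _ _)) (za0 _ _ _ (anx _ _)) !mul0r subr0.
under [X in _ = X - _ + _]eq_bigr do under eq_bigr do
  rewrite /face12 (za0 _ _ _ (axxn _ _)) mul0r sub0r.
under [X in _ = X - _ + _]eq_bigr do rewrite sumrN.
rewrite sumrN !big1_eq subr0 addr0.
set s := \sum_(0 <= i < n) _; suff -> : s = 1 by [].
(* Outside of the square [[p, q[^2] the factor [a] kills the bottom terms. *)
have sub (f : nat -> int) :
    \sum_(0 <= i < n) (if (p <= i < q)%N then f i else 0) =
    \sum_(p <= i < q) f i.
  have pn : (p <= n)%N by lia.
  rewrite -big_mkcond /= (big_cat_nat (n := p)) //=.
  rewrite big_nat_cond big_pred0 ?add0r; last by move=> i; lia.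
  rewrite (big_cat_nat (n := q)) ?(ltnW pq) //=.
  rewrite [X in _ + X]big_nat_cond [X in _ + X]big_pred0 ?addr0;
    last by move=> i; lia.
  by rewrite big_nat_cond [RHS]big_nat_cond; apply: eq_bigl => i; lia.
have -> : s = \sum_(p <= i < q) \sum_(p <= j < q)
    cup2 (fun i j => z b i j 0%N) (fun i j => z c i j 0%N) i j.
  rewrite -sub; apply: congr_big_nat => // i ni.
  case: ifP => Hi; last first.
    rewrite big_nat big1 // => j nj.
    by rewrite /z abot ?Hi ?mul0r //; lia.
  rewrite -sub; apply: congr_big_nat => // j nj.
  by rewrite {1}/z abot ?Hi /=; [case: ifP; rewrite ?mul1r ?mul0r|lia|lia].
rewrite cup2_stokes ?(ltnW pq) //.
rewrite [X in _ - X]big_nat [X in _ - X]big1 ?subr0; last first.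
  move=> i iq; have [c1 c2] := cc i ltac:(lia);
    have [c3 c4] := cc i.+1 ltac:(lia).
  by rewrite /z c1 c2 c3 c4 !subrr !mulr0.
have [c1 c2] := cc q ltac:(lia).
rewrite (eq_big_nat _ _ (F2 := fun j => z c q j.+1 0%N - z c q j 0%N));
  last first.
  by move=> j jq; have [b1 b2] := bb j ltac:(lia);
    rewrite {1 4}/z b1 b2 mul1r mul0r subr0.
by rewrite (telescope_sumr (fun j => z c q j 0%N)) ?(ltnW pq) // /z c1 c2.
Qed.
End Cube.

(** * The shrinking sphere *)

(** Case analysis on the innermost minima and maxima of the goal, which leaves
    linear inequalities. *)
Ltac split_minmax := repeat match goal with
  | |- context [Order.min ?a ?b] =>
      lazymatch constr:((a, b)) with
      | context [Order.min] => fail | context [Order.max] => fail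
      | _ => case: (lerP a b) => ? end
  | |- context [Order.max ?a ?b] =>
      lazymatch constr:((a, b)) with
      | context [Order.min] => fail | context [Order.max] => fail
      | _ => case: (lerP a b) => ? end
  end.

Section Space.
Local Open Scope classical_set_scope.
Local Open Scope ring_scope.
Variable R : realType.
Implicit Types (r t : R) (s : R * R) (p q : R * R * R).

Definition dist3 p q : R :=
  Num.max `|p.1.1 - q.1.1| (Num.max `|p.1.2 - q.1.2| `|p.2 - q.2|).

Lemma dist3_leP p q t : reflect
  [/\ `|p.1.1 - q.1.1| <= t, `|p.1.2 - q.1.2| <= t & `|p.2 - q.2| <= t]
  (dist3 p q <= t).
Proof. by rewrite /dist3 !ge_max; apply: and3P. Qed.

(** The parametrization of the sphere is precomposed with the retraction of the
    plane onto the unit square, which makes it globally Lipschitz and spares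
    domain conditions. *)
Definition clamp t : R := Num.max 0 (Num.min t 1).

Lemma clamp_itv t : 0 <= clamp t <= 1.
Proof. by rewrite /clamp; split_minmax; lra. Qed.

Lemma clamp_id t : 0 <= t <= 1 -> clamp t = t.
Proof. by move=> /andP[? ?]; rewrite /clamp; split_minmax; lra. Qed.

Lemma clamp_lipschitz t t' : `|clamp t - clamp t'| <= `|t - t'|.
Proof.
have ? := ler_norm (t - t'); have := ler_norm (t' - t); rewrite distrC => ?.
by rewrite ler_norml /clamp; split_minmax; lra.
Qed.

(** For [s] in the unit square, the distance to the boundary in the maximum
    norm. *)
Definition inradius s : R :=
  Num.min (Num.min s.1 (1 - s.1)) (Num.min s.2 (1 - s.2)).

(** A map that is injective inside the square, because [s] is the quotient of the
    last two coordinates by the first one, and collapses the boundary to the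
    origin: its image is the sphere obtained from the square by identifying the
    boundary to a point, and it encloses the point [(1/4, 1/8, 1/8)].  Rational
    points have rational images at rational distances. *)
Definition bubble s : R * R * R :=
  (inradius s, inradius s * s.1, inradius s * s.2).

Definition scale3 r p : R * R * R := (r * p.1.1, r * p.1.2, r * p.2).

Definition clamp2 s : R * R := (clamp s.1, clamp s.2).

Definition bubble_map r s : R * R * R := scale3 r (bubble (clamp2 s)).

(** A sphere for [r > 0], a point for [r = 0]. *)
Definition bubble_space r : Type := set_type (range (bubble_map r)).

HB.instance Definition _ r := Choice.on (bubble_space r).

Lemma dist3_scale r p q : 0 <= r ->
  dist3 (scale3 r p) (scale3 r q) = r * dist3 p q.
Proof.
move=> r0; rewrite /dist3 /= -!mulrBr !normrM (ger0_norm r0).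
by rewrite !maxr_pMr.
Qed.

Section Metric.
Variable r : R.
Let dist (x y : bubble_space r) := dist3 (val x) (val y).

Let distxx x : dist x x = 0.
Proof. by rewrite /dist /dist3 !subrr normr0 !maxxx. Qed.

Let dist_pos x y : dist x y = 0 -> x = y.
Proof.
rewrite /dist => d0; apply: val_inj.
have /dist3_leP : dist3 (val x) (val y) <= 0 by rewrite d0.
case: (val x) (val y) => [[a b] c] [[a' b'] c'] /=.
by rewrite !normr_le0 !subr_eq0 => -[/eqP-> /eqP-> /eqP->].
Qed.

Let dist_sym x y : dist x y = dist y x.
Proof.
rewrite /dist /dist3 (distrC (val x).1.1) (distrC (val x).1.2).
by rewrite (distrC (val x).2).
Qed.

Let dist_tri y x z : dist x z <= dist x y + dist y z.
Proof.
have /dist3_leP[a1 a2 a3] := lexx (dist x y).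
have /dist3_leP[b1 b2 b3] := lexx (dist y z).
by apply/dist3_leP; split; (apply: le_trans (ler_distD _ _ _) _; apply: lerD);
  eassumption.
Qed.

HB.instance Definition _ := isMetric.Build R (bubble_space r) distxx dist_pos
  dist_sym dist_tri.

Lemma mdistE (x y : bubble_space r) : mdist x y = dist3 (val x) (val y).
Proof. by []. Qed.

End Metric.

Definition bubble_pt r s : bubble_space r :=
  exist _ (bubble_map r s) (mem_set (imageT (bubble_map r) s)).

Lemma min_lipschitz (a b a' b' d : R) : `|a - a'| <= d -> `|b - b'| <= d ->
  `|Num.min a b - Num.min a' b'| <= d.
Proof.
by rewrite !ler_norml => /andP[? ?] /andP[? ?]; split_minmax; lra.
Qed.

Lemma inradius_lipschitz s s' d :
  `|s.1 - s'.1| <= d -> `|s.2 - s'.2| <= d -> `|inradius s - inradius s'| <= d.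
Proof.
have E (a b : R) : 1 - a - (1 - b) = b - a by ring.
by move=> ? ?; do !apply: min_lipschitz; rewrite ?E 1?distrC // distrC.
Qed.

Lemma inradius_itv s : 0 <= s.1 <= 1 -> 0 <= s.2 <= 1 -> 0 <= inradius s <= 2^-1.
Proof. by rewrite /inradius => /andP[? ?] /andP[? ?]; split_minmax; lra. Qed.

(** Both factors of the coordinates [m * s_i] are [1]-Lipschitz, with [s_i <= 1]
    and [m <= 1/2]: hence the constant [1 + 1/2]. *)
Lemma bubble_lipschitz r s s' d : 0 <= r ->
  `|s.1 - s'.1| <= d -> `|s.2 - s'.2| <= d ->
  mdist (bubble_pt r s) (bubble_pt r s') <= r * (3 / 2 * d).
Proof.
move=> r0 /(le_trans (clamp_lipschitz _ _)) d1.
move=> /(le_trans (clamp_lipschitz _ _)) d2.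
rewrite mdistE /= dist3_scale // ler_wpM2l //.
have dm := @inradius_lipschitz (clamp2 s) (clamp2 s') d d1 d2.
have /andP[m0 m1] := @inradius_itv (clamp2 s') (clamp_itv _) (clamp_itv _).
have d0 : 0 <= d := le_trans (normr_ge0 _) d1.
have coord (x y : R) : 0 <= x <= 1 -> `|x - y| <= d ->
    `|inradius (clamp2 s) * x - inradius (clamp2 s') * y| <= 3 / 2 * d.
  move=> /andP[x0 x1] xy.
  have -> : inradius (clamp2 s) * x - inradius (clamp2 s') * y =
      (inradius (clamp2 s) - inradius (clamp2 s')) * x
      + inradius (clamp2 s') * (x - y) by ring.
  apply: le_trans (ler_normD _ _) _.
  rewrite !normrM (ger0_norm x0) (ger0_norm m0).
  have : `|inradius (clamp2 s) - inradius (clamp2 s')| * x <= d * 1 by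
    apply: ler_pM.
  have : inradius (clamp2 s') * `|x - y| <= 2^-1 * d by apply: ler_pM.
  lra.
by apply/dist3_leP; split => /=; [lra|apply: coord => //; exact: clamp_itv..].
Qed.

Lemma continuous_bubble r : 0 <= r -> continuous (bubble_pt r).
Proof.
move=> r0 s U /nbhs_ballP[e /= e0 eU].
have d0 : 0 < e / (r * 2 + 1) by rewrite divr_gt0 //; lra.
exists (ball s.1 (e / (r * 2 + 1)), ball s.2 (e / (r * 2 + 1))).
  by split; apply: nbhsx_ballx.
move=> s' [/ltW d1 /ltW d2]; apply: eU; rewrite ballEmdist /=.
apply: le_lt_trans (bubble_lipschitz r0 d1 d2) _.
have -> : r * (3 / 2 * (e / (r * 2 + 1))) = e * (r * (3 / 2) / (r * 2 + 1)).
  by field; lra.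
by rewrite -ltr_pdivlMl // mulVf ?gt_eqF // ltr_pdivrMr; lra.
Qed.

Lemma val_bubble_pt r s : 0 <= s.1 <= 1 -> 0 <= s.2 <= 1 ->
  val (bubble_pt r s) = scale3 r (bubble s).
Proof.
by case: s => s1 s2 /= h1 h2; rewrite /bubble_map /clamp2 /= !clamp_id.
Qed.

Lemma bubble_pt_ind r (x : bubble_space r) :
  exists s, [/\ 0 <= s.1 <= 1, 0 <= s.2 <= 1 & x = bubble_pt r s].
Proof.
case: x => p ps; have [s _ sp] := set_mem ps.
exists (clamp2 s); split; [exact: clamp_itv..|].
apply: val_inj => /=; rewrite -sp /bubble_map /clamp2 /=.
by rewrite ![clamp (clamp _)]clamp_id //; exact: clamp_itv.
Qed.

Lemma squareP s : square s <-> 0 <= s.1 <= 1 /\ 0 <= s.2 <= 1.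
Proof. by rewrite /square /= !in_itv. Qed.

Lemma compact_square : compact (@square R).
Proof. by apply: compact_setX; exact: segment_compact. Qed.

Lemma compact_bubble_space r : 0 <= r -> compact [set: bubble_space r].
Proof.
move=> r0; have -> : [set: bubble_space r] = bubble_pt r @` @square R.
  apply/seteqP; split => // x _; have [s [s1 s2 ->]] := bubble_pt_ind x.
  by exists s => //; apply/squareP.
apply: continuous_compact compact_square.
by apply: continuous_subspaceT; exact: continuous_bubble.
Qed.

Lemma bubble_boundary r s :
  square_boundary s -> bubble_pt r s = bubble_pt r (0, 0).
Proof.
move=> [/squareP[s1 s2] bs]; apply: val_inj; rewrite !val_bubble_pt ?lexx
  ?ler01 //.
have z s' : inradius s' = 0 -> scale3 r (bubble s') = (0, 0, 0).
  by rewrite /scale3 /bubble /= => ->; rewrite !(mul0r, mulr0).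
rewrite !z // /inradius /=; first by rewrite subr0; split_minmax; lra.
move: s1 s2 => /andP[? ?] /andP[? ?].
by case: bs => E; split_minmax; lra.
Qed.

(** The coordinates relative to the enclosed point, whose simultaneous vanishing
    is to be excluded. *)
Definition side r (i : 'I_3) (x : bubble_space r) : R :=
  tnth [tuple (val x).1.1 - r / 4; (val x).1.2 - r / 8; (val x).2 - r / 8] i.

Lemma side_lipschitz r i (x y : bubble_space r) :
  `|side i x - side i y| <= mdist x y.
Proof.
have /dist3_leP[d1 d2 d3] := lexx (dist3 (val x) (val y)); rewrite mdistE.
have E (a b c : R) : a - c - (b - c) = a - b by ring.
by case: i => -[|[|[|//]]] ?; rewrite /side !(tnth_nth 0) /= E.
Qed.

(** At a common zero the inradius would be [1/4] and both coordinates of [s] would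
    be [1/2]; but the centre of the square has inradius [1/2]. *)
Lemma side_neq0 r (x : bubble_space r) : 0 < r -> exists i, side i x != 0.
Proof.
move=> r0; have [s [s1 s2 ->]] := bubble_pt_ind x.
apply: contrapT => /forallNP H.
have {}H i : side i (bubble_pt r s) = 0.
  by move/negP: (H i); rewrite negbK => /eqP.
have := H ord0; have := H (lift ord0 ord0); have := H ord_max.
rewrite /side val_bubble_pt // !(tnth_nth 0) /=.
have div8 (t : R) : r * t - r / 8 = 0 -> t = 8^-1.
  by rewrite -mulrBr => /eqP; rewrite mulf_eq0 gt_eqF //= subr_eq0 => /eqP.
move=> /div8 e3 /div8 e2 e1.
have m4 : inradius s = 4^-1.
  move: e1; rewrite -mulrBr => /eqP.
  by rewrite mulf_eq0 gt_eqF //= subr_eq0 => /eqP.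
rewrite m4 in e2 e3; move: m4; rewrite /inradius.
by split_minmax; lra.
Qed.

End Space.

(** * Second homotopy groups of the sphere and of a point *)

Section Nontrivial.
Local Open Scope classical_set_scope.
Local Open Scope ring_scope.
Variable R : realType.

(** Clamped at [1], so that all the indices give points of the unit interval. *)
Definition grid (n i : nat) : R := (minn i n)%:R / n%:R.

Lemma grid_itv n i : 0 <= grid n i <= 1.
Proof.
rewrite /grid divr_ge0 //=; case: n => [|n]; first by rewrite invr0 mulr0 ler01.
by rewrite ler_pdivrMr ?ltr0n // mul1r ler_nat geq_minr.
Qed.

Lemma grid_id n i : (i <= n)%N -> grid n i = i%:R / n%:R.
Proof. by rewrite /grid => /minn_idPl ->. Qed.

Lemma grid0 n : grid n 0 = 0.
Proof. by rewrite /grid min0n mul0r. Qed.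

Lemma gridn n : (0 < n)%N -> grid n n = 1.
Proof. by move=> n0; rewrite /grid minnn divff // pnatr_eq0 -lt0n. Qed.

Lemma grid_succ n i (x : bool) : `|grid n i - grid n (x + i)| <= n%:R^-1.
Proof.
rewrite /grid -mulrBl normrM [`|_^-1|]ger0_norm ?invr_ge0 //.
rewrite ler_piMl ?invr_ge0 // distrC -natrB; last by lia.
by rewrite normr_nat lern1; case: x; lia.
Qed.

(** Grids have [4 * m] steps in order to contain the points [1/4] and [3/4]. *)
Lemma archi_inv (d : R) : 0 < d -> exists2 m, (3 < m)%N & (4 * m)%:R^-1 < d.
Proof.
move=> d0; pose m := Num.truncn d^-1.
exists (m + 4)%N; first by lia.
rewrite -[d]invrK ltf_pV2 ?posrE ?invr_gt0 ?ltr0n //; last by lia.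
apply: lt_le_trans (truncnS_gt _) _; rewrite ler_nat -/m; lia.
Qed.

(** Label the points of a fine grid by the signs of the three [side]s of [F].  The
    label [a] of the first coordinate is [0] on the five faces of the cube where
    [F] is constant.  On the bottom face it singles out the points with both
    coordinates strictly between [1/4] and [3/4]; on the boundary of that square
    the other two labels behave as [trichromatic_cube] requires.  So for every
    mesh some cube sees sign changes of all three sides, although near each point
    some side has a constant sign, with a uniform radius by [lebesgue_number]. *)
Lemma sphere_essential (r : R) : 0 < r ->
  ~ homotopic2 (bubble_pt r (0, 0)) (bubble_pt r) (fun=> bubble_pt r (0, 0)).
Proof.
move=> r0 [F [cF F0 F1 Fb]].
pose K : set (R * R * R) := @square R `*` `[0, 1].
have cK : compact K.
  by apply: compact_setX; [exact: compact_square|exact: segment_compact].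
pose S (u : 'I_3 * bool) : set ((R * R) * R) :=
  [set p | (0 < side u.1 (F p)) = u.2].
have cov p : K p -> exists u, \forall y \near p, K y -> S u y.
  move=> Kp; have [i ni] := side_neq0 (F p) r0.
  exists (i, 0 < side i (F p)).
  have /subspace_continuousP/(_ p Kp) := cF.
  move=> /(_ (ball (F p) `|side i (F p)|)) /= [].
    by apply: nbhsx_ballx; rewrite normr_gt0.
  move=> e /= e0 H; exists e => //= q pq Kq.
  have := H q pq Kq; rewrite ballEmdist /= => Hq.
  have := le_lt_trans (side_lipschitz i (F p) (F q)) Hq.
  rewrite /S /=; move: (side i (F p)) (side i (F q)) ni => x y x0.
  rewrite ltr_norml => /andP[h1 h2]; case: (ltgtP x 0) x0 => // x0 _.
    by rewrite (ltr0_norm x0) in h1 h2; apply/negbTE; rewrite -leNgt; lra.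
  by rewrite (gtr0_norm x0) in h1 h2; lra.
have [d d0 leb] := lebesgue_number cK cov.
have [m m3 md] := archi_inv d0.
set n := (4 * m)%N in md.
have n0 : (0 < n)%N by rewrite /n; lia.
pose pt i j k : (R * R) * R := (grid n i, grid n j, grid n k).
have Kpt i j k : K (pt i j k).
  by split; [apply/squareP; split; exact: grid_itv|rewrite /= in_itv /=;
    exact: grid_itv].
pose lab (u : 'I_3) i j k : bool := 0 < side u (F (pt i j k)).
(* For positive [r] the labels are inequalities between unscaled coordinates. *)
have labE i j k x : F (pt i j k) = bubble_pt r x ->
  0 <= x.1 <= 1 -> 0 <= x.2 <= 1 ->
  [/\ lab ord0 i j k = (4^-1 < inradius x),
      lab (lift ord0 ord0) i j k = (8^-1 < inradius x * x.1) &
      lab ord_max i j k = (8^-1 < inradius x * x.2)].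
  move=> E x1 x2; rewrite /lab E /side val_bubble_pt // !(tnth_nth 0) /=.
  by rewrite -!mulrBr !pmulr_rgt0 // !subr_gt0.
have in00 : inradius (0, 0) = 0 :> R.
  by rewrite /inradius /= subr0; split_minmax; lra.
have lab0 i j k : F (pt i j k) = bubble_pt r (0, 0) -> lab ord0 i j k = false.
  move=> E; have [] := labE _ _ _ _ E; rewrite ?lexx ?ler01 // => -> _ _.
  by rewrite in00; apply/negbTE; rewrite -leNgt; lra.
have sq i j : square (grid n i, grid n j).
  by apply/squareP; split; exact: grid_itv.
have labb i j k : square_boundary (grid n i, grid n j) -> lab ord0 i j k = false.
  by move=> sb; apply: lab0; apply: Fb => //; exact: grid_itv.
have m0 : 4 <= m%:R :> R by rewrite (ler_nat R 4).
have gm i : (i <= n)%N -> grid n i = i%:R / (4 * m%:R).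
  by move=> ni; rewrite grid_id // natrM.
have g_lo i : (i <= n)%N -> (4^-1 < grid n i) = (m < i)%N.
  move=> ni; rewrite gm // ltr_pdivlMr; last lra.
  by rewrite mulrA mulVf // mul1r ltr_nat.
have g_hi i : (i <= n)%N -> (grid n i < 3 / 4) = (i < 3 * m)%N.
  move=> ni; rewrite gm // ltr_pdivrMr; last lra.
  by rewrite (_ : 3 / 4 * (4 * m%:R) = (3 * m)%:R) ?ltr_nat // natrM; field.
have g_q : grid n (3 * m) = 3 / 4.
  by rewrite gm /n ?natrM; [field; lra|lia].
(* The square starts at the index [m.+1], slightly inside: [m >= 4] leaves it
   below [5/16], where the product of two coordinates is less than [1/8]. *)
have g_p : grid n m.+1 <= 5 / 16.
  by rewrite gm /n; [rewrite -[m.+1%:R]natr1 ler_pdivrMr; lra|lia].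
have mid j : (m.+1 <= j <= 3 * m)%N -> 4^-1 <= grid n j <= 3 / 4.
  move=> jpq; rewrite ltW ?g_lo /n /=; try lia.
  rewrite leNgt -g_q gm ?gm /n; [|lia|lia].
  by rewrite ltr_pM2r ?ltr_nat ?invr_gt0; [lia|lra].
have bot i j := labE i j 0%N (grid n i, grid n j)
  (etrans (congr1 (fun t => F (_, t)) (grid0 n)) (F0 _ (sq i j)))
  (grid_itv _ _) (grid_itv _ _).
have low (t u : R) : t <= u -> 0 <= u <= 1 -> u <= 5 / 16 ->
  (8^-1 < t * u) = false.
  by move=> tu /andP[u0 _] u5; apply/negbTE; rewrite -leNgt; nra.
have inr1 (x : R * R) : inradius x <= x.1 by rewrite /inradius !ge_min lexx.
have inr2 (x : R * R) : inradius x <= x.2 by rewrite /inradius !ge_min lexx !orbT.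
have inr_ge (x : R * R) : 4^-1 <= x.1 <= 3 / 4 -> 4^-1 <= x.2 <= 3 / 4 ->
  4^-1 <= inradius x.
  by move=> /andP[? ?] /andP[? ?]; rewrite /inradius !le_min; lra.
have := @trichromatic_cube (lab ord0) (lab (lift ord0 ord0)) (lab ord_max)
  n m.+1 (3 * m).
case.
- by rewrite /n; lia.
- by move=> j k; apply: labb; split => //; apply: Or41; exact: grid0.
- by move=> j k; apply: labb; split => //; apply: Or42; exact: gridn.
- by move=> j k; apply: labb; split => //; apply: Or43; exact: grid0.
- by move=> j k; apply: labb; split => //; apply: Or44; exact: gridn.
- by move=> i j; apply: lab0; rewrite /pt gridn // F1.
- move=> i j ni nj; have [-> _ _] := bot i j.
  rewrite -(g_lo i (ltnW ni)) -(g_hi i (ltnW ni)).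
  rewrite -(g_lo j (ltnW nj)) -(g_hi j (ltnW nj)).
  rewrite /inradius !lt_min /=; congr (_ && _); congr (_ && _); lra.
- move=> j jpq; have [_ -> _] := bot m.+1 j; have [_ -> _] := bot (3 * m)%N j.
  split; first by apply: low => //=; exact: grid_itv.
  have := inr_ge (grid n (3 * m), grid n j) _ (mid _ jpq); rewrite /= g_q; lra.
- move=> j jpq; have [_ _ ->] := bot j m.+1; have [_ _ ->] := bot j (3 * m)%N.
  split; first by apply: low => //=; exact: grid_itv.
  have := inr_ge (grid n j, grid n (3 * m)) (mid _ jpq) _; rewrite /= g_q; lra.
move=> i [j [k [_ [na nb nc]]]].
have [[u b] Hu] := leb _ (Kpt i j k).
have Su p : K p -> ball (pt i j k) d p -> (0 < side u (F p)) = b.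
  by move=> Kp Bp; exact: (Hu p).
have const : constant_on_cube (lab u) i j k.
  move=> x y z; rewrite /lab !Su //; first exact: ballxx.
  by split; [split|]; exact: le_lt_trans (grid_succ _ _ _) md.
case: u const {Hu Su} => -[|[|[|//]]] iu const.
- by apply: na; move: const; rewrite (_ : Ordinal iu = ord0) //; exact: val_inj.
- by apply: nb; move: const; rewrite (_ : Ordinal iu = lift ord0 ord0) //;
  exact: val_inj.
- by apply: nc; move: const; rewrite (_ : Ordinal iu = ord_max) //;
  exact: val_inj.
Qed.

Lemma homotopic2_cst (X : topologicalType) (x0 : X) :
  homotopic2 x0 (fun=> x0) (fun=> x0 : X) (R := R).
Proof.
exists (fun=> x0); split => //.
by apply: continuous_subspaceT => p; exact: cvg_cst.
Qed.

Lemma sphere2_bubble (r : R) :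
  0 <= r -> sphere2 (bubble_pt r (0, 0)) (bubble_pt r).
Proof.
move=> r0; split; last exact: bubble_boundary.
by apply: continuous_subspaceT; exact: continuous_bubble.
Qed.

Lemma sphere2_cst (X : topologicalType) (x0 : X) :
  sphere2 x0 (fun=> x0 : X) (R := R).
Proof. by split => //; apply: continuous_subspaceT => s; exact: cvg_cst. Qed.

(** In a one-element [pi2] the classes of the parametrization and of the constant
    sphere coincide. *)
Lemma pi2_sphere_nontrivial (r : R) :
  0 < r -> ~ pi2_trivial R (bubble_pt r (0, 0)).
Proof.
move=> r0 [e _ pi_e]; apply: (sphere_essential r0).
set x0 := bubble_pt r (0, 0).
have e1 : homotopy_class2 x0 (bubble_pt r) = e.
  suff : pi2 (R := R) x0 (homotopy_class2 x0 (bubble_pt r)) by rewrite pi_e.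
  by exists (bubble_pt r) => //; apply: sphere2_bubble; exact: ltW.
have e2 : homotopy_class2 x0 (fun=> x0) = e :> set (R * R -> _).
  suff : pi2 (R := R) x0 (homotopy_class2 x0 (fun=> x0)) by rewrite pi_e.
  by exists (fun=> x0) => //; exact: sphere2_cst.
suff [] : homotopy_class2 x0 (bubble_pt r) (fun=> x0) by [].
rewrite e1 -e2; split; first exact: sphere2_cst.
exact: homotopic2_cst.
Qed.

Lemma pi2_point_trivial (X : topologicalType) (x0 : X) :
  (forall x : X, x = x0) -> pi2_trivial R x0.
Proof.
move=> allx; have allf (f : R * R -> X) : f = fun=> x0 by apply/funext => s.
have class f : homotopy_class2 x0 f = [set: R * R -> X].
  apply/seteqP; split => // g _; rewrite (allf f) (allf g).
  by split; [exact: sphere2_cst|exact: homotopic2_cst].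
have piE : pi2 (R := R) x0 = [set [set: R * R -> X]].
  apply/seteqP; split => [A [f _ <-]|A ->]; first exact: class.
  by exists (fun=> x0); [exact: sphere2_cst|exact: class].
exists [set: R * R -> X] => //; split; first by rewrite piE.
have mulTT : pi2_mul x0 [set: R * R -> X] [set: R * R -> X] = [set: R * R -> X].
  apply/seteqP; split => // h _; exists (fun=> x0) => //; exists (fun=> x0) => //.
  by rewrite class.
by move=> A; rewrite piE => ->; rewrite mulTT.
Qed.
End Nontrivial.

(** * Distances between named points *)

(** The name [npair (npair k l) n] stands for the image of the point
    [(k / n.+1, l / n.+1)], clamped to the square.  The next definitions are the
    numerators and denominators, as natural numbers, of all the quantities that
    enter the distance of two named points. *)
Definition name_den (i : nat) : nat := (unpair i).2.+1.
Definition name_x (i : nat) : nat := minn (unpair (unpair i).1).1 (name_den i).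
Definition name_y (i : nat) : nat := minn (unpair (unpair i).1).2 (name_den i).
Definition name_inr (i : nat) : nat :=
  minn (minn (name_x i) (name_den i - name_x i))
    (minn (name_y i) (name_den i - name_y i)).

Definition adiff (x y : nat) : nat := (x - y) + (y - x).

(** The numerator of [f i / name_den i ^ 2 - f j / name_den j ^ 2] in absolute
    value, over the denominator [dist_den i j]. *)
Definition cross_diff (f : nat -> nat) (i j : nat) : nat :=
  adiff (f i * name_den j ^ 2) (f j * name_den i ^ 2).

Definition dist_num (i j : nat) : nat :=
  maxn (cross_diff (fun i => name_inr i * name_den i) i j)
    (maxn (cross_diff (fun i => name_inr i * name_x i) i j)
       (cross_diff (fun i => name_inr i * name_y i) i j)).

Definition dist_den (i j : nat) : nat := name_den i ^ 2 * name_den j ^ 2.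

Section Names.
Local Open Scope ring_scope.
Local Open Scope classical_set_scope.
Variable R : realType.

Definition name_pt (i : nat) : R * R :=
  (grid R (name_den i) (unpair (unpair i).1).1,
    grid R (name_den i) (unpair (unpair i).1).2).

Lemma natr_min (m n : nat) : (minn m n)%:R = Num.min m%:R n%:R :> R.
Proof. by rewrite /minn /Order.min ltr_nat; case: ifP. Qed.

Lemma natr_max (m n : nat) : (maxn m n)%:R = Num.max m%:R n%:R :> R.
Proof. by rewrite /maxn /Order.max ltr_nat; case: ifP. Qed.

Lemma natr_adiff (m n : nat) : (adiff m n)%:R = `|m%:R - n%:R| :> R.
Proof.
rewrite /adiff; case: (leqP m n) => mn.
  by rewrite (eqP mn) add0n distrC -natrB // normr_nat.
by rewrite (eqP (ltnW mn)) addn0 -natrB ?(ltnW mn) // normr_nat.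
Qed.

Lemma inradius_name i :
  inradius (name_pt i) = (name_inr i)%:R / (name_den i)%:R.
Proof.
have d0 : 0 < (name_den i)%:R :> R by rewrite ltr0n.
have dV : 0 <= (name_den i)%:R^-1 :> R by rewrite invr_ge0 ltW.
have side k : 1 - grid R (name_den i) k =
    (name_den i - minn k (name_den i))%N%:R / (name_den i)%:R.
  by rewrite /grid natrB ?geq_minr // mulrBl divff // gt_eqF.
rewrite /inradius /= !side /name_inr /name_x /name_y !natr_min.
by rewrite /grid !natr_min -!minr_pMl.
Qed.

Lemma dist_nameE (r : R) i j : 0 <= r ->
  mdist (bubble_pt r (name_pt i)) (bubble_pt r (name_pt j)) =
  r * ((dist_num i j)%:R / (dist_den i j)%:R).
Proof.
move=> r0; rewrite mdistE !val_bubble_pt; try exact: grid_itv.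
rewrite dist3_scale //; congr (_ * _).
have di k : (name_den k)%:R != 0 :> R by rewrite pnatr_eq0.
have cross (f : nat -> nat) :
    `|(f i)%:R / (name_den i)%:R ^+ 2 - (f j)%:R / (name_den j)%:R ^+ 2| =
    (cross_diff f i j)%:R / (dist_den i j)%:R :> R.
  rewrite /cross_diff natr_adiff -[(dist_den i j)%:R]normr_nat -normf_div.
  by congr `|_|; rewrite /dist_den !(natrM, natrX); field; rewrite !di.
rewrite /dist_num !natr_max !maxr_pMl ?invr_ge0 // -!cross /dist3 /bubble /=.
rewrite !inradius_name /name_pt /grid !natrM /name_x /name_y.
by congr Order.max; last congr Order.max; congr Num.norm; field; rewrite !di.
Qed.

Lemma ratr_decode n :
  ratr (decode_rat n) = (unpair n).1%:R / (unpair n).2.+1%:R :> R.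
Proof. by rewrite /decode_rat fmorph_div !rmorph_nat. Qed.

Lemma ratr_decode_npair a b :
  ratr (decode_rat (npair a b)) = a%:R / b.+1%:R :> R.
Proof. by rewrite ratr_decode npairK. Qed.

(** A number that is [0] iff [h] never holds, and that is known up to [1 / n] once
    [h] is tested below [n]. *)
Definition halt_radius (h : pred nat) : R :=
  if pselect (exists n, h n) is left ex then (ex_minn ex).+1%:R^-1 else 0.

Lemma halt_radius_itv h : 0 <= halt_radius h <= 1.
Proof.
rewrite /halt_radius; case: pselect => [ex|_]; last by rewrite lexx ler01.
by rewrite invr_ge0 ler0n invf_le1 ?ltr0n // ler1n.
Qed.

Lemma halt_radius_gt0 (h : pred nat) n : h n -> 0 < halt_radius h.
Proof.
by rewrite /halt_radius => hn; case: pselect => [ex|[]];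
  [rewrite invr_gt0 ltr0n|exists n].
Qed.

Lemma halt_radius_eq0 (h : pred nat) : (forall n, ~~ h n) -> halt_radius h = 0.
Proof.
by rewrite /halt_radius => hN; case: pselect => // -[n hn]; move: (hN n);
  rewrite hn.
Qed.

(** The bound of the search is at least [2 / eps].  A radius that is not found
    below it is smaller than [eps / 2], so all the distances are smaller than
    [eps] and [0] approximates them.  Otherwise the answer is exact. *)
Definition approx_dist (h : pred nat) (i j e : nat) : nat :=
  if search (fun n => if h n then 1 else 2)%N (2 * (unpair e).2.+1) is n.+1
  then npair (dist_num i j) (n.+1 * dist_den i j).-1 else npair 0 0.

Lemma approx_distP h i j e : 0 < decode_rat e ->
  `|mdist (bubble_pt (halt_radius h) (name_pt i))
      (bubble_pt (halt_radius h) (name_pt j))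
    - ratr (decode_rat (approx_dist h i j e))| < ratr (decode_rat e).
Proof.
move=> e0; have {e0} : 0 < ratr (decode_rat e) :> R by rewrite ltr0q.
have /andP[r0 r1] := halt_radius_itv h.
rewrite /approx_dist; set v := fun n => _; set K := (2 * (unpair e).2.+1)%N.
case E: (search v K) => [|n].
  have hK n : h n -> (K <= n)%N.
    move=> hn; rewrite leqNgt; apply/negP => nK.
    have ex : exists n, h n by exists n.
    case: (ex_minnP ex) => m hm minm.
    suff : search v K = m.+1 by rewrite E.
    apply/search_succ; split; rewrite /v ?hm //.
      by apply: leq_ltn_trans nK; exact: minm.
    move=> k km; exists 0%N; case: ifP => // hk.
    by move: (minm _ hk); rewrite leqNgt km.
  rewrite ratr_decode_npair mul0r subr0 ger0_norm ?mdist_ge0 // => ep.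
  have near (k k' : R * R) : 0 <= k.1 <= 1 -> 0 <= k.2 <= 1 -> 0 <= k'.1 <= 1 ->
      0 <= k'.2 <= 1 -> `|k.1 - k'.1| <= 1 /\ `|k.2 - k'.2| <= 1.
    by rewrite !ler_norml => /andP[? ?] /andP[? ?] /andP[? ?] /andP[? ?];
      split; lra.
  have [d1 d2] := near (name_pt i) (name_pt j) (grid_itv _ _ _) (grid_itv _ _ _)
    (grid_itv _ _ _) (grid_itv _ _ _).
  apply: le_lt_trans (bubble_lipschitz r0 d1 d2) _.
  move: ep; rewrite !ratr_decode => ep.
  have : 1 <= (unpair e).1%:R :> R.
    by rewrite ler1n lt0n; apply: contraTneq ep => ->; rewrite mul0r ltxx.
  move=> a1.
  have : (unpair e).2.+1%:R^-1 <= (unpair e).1%:R / (unpair e).2.+1%:R :> R.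
    by rewrite ler_peMl // invr_ge0.
  apply: lt_le_trans.
  rewrite /halt_radius; case: pselect => [ex|_];
    last by rewrite mul0r invr_gt0 ltr0n.
  case: ex_minnP => m /hK Km _.
  rewrite -ltr_pdivlMr; last lra.
  rewrite -invfM ltf_pV2 ?posrE ?mulr_gt0 ?ltr0n //.
  apply: (@lt_le_trans _ _ K.+1%:R); last by rewrite ler_nat.
  by rewrite -[K.+1%:R]natr1 /K natrM; have : 0 < (unpair e).2.+1%:R :> R;
    [rewrite ltr0n|lra].
move/search_succ: E => [nK hn hm].
have -> : halt_radius h = n.+1%:R^-1.
  rewrite /halt_radius; case: pselect => [ex|[]]; last first.
    by exists n; move: hn; rewrite /v; case: ifP.
  case: ex_minnP => m h_m minm; congr (_.+1%:R^-1); apply/eqP; rewrite eqn_leq.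
  rewrite minm /=; last by move: hn; rewrite /v; case: ifP.
  rewrite leqNgt; apply/negP => mn; have [z] := hm _ mn.
  by rewrite /v h_m.
rewrite dist_nameE ?invr_ge0 // ratr_decode_npair.
rewrite prednK; last by rewrite muln_gt0 /= /dist_den muln_gt0 !expn_gt0.
rewrite natrM invfM [_ * (_ / _)]mulrCA mulrA [X in X * _]mulrC -mulrA.
by rewrite subrr normr0.
Qed.
End Names.

(** * Constructive compactness *)

(** A net may contain superfluous points, so it can consist of all the names below
    a bound; such a list is computed by primitive recursion. *)
Fixpoint names_below (n : nat) : seq nat :=
  if n is m.+1 then m :: names_below m else [::].

Lemma mem_names_below n i : (i \in names_below n) = (i < n).
Proof. by elim: n => //= n IH; rewrite inE IH ltnS [RHS]leq_eqVlt. Qed.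

Lemma leq_npair m m' n n' : m <= m' -> n <= n' -> npair m n <= npair m' n'.
Proof.
move=> mm' nn'; have := Cantor.to_nat_spec m n; have := Cantor.to_nat_spec m' n'.
rewrite /npair; nia.
Qed.

(** A positive precision [eps] is at least [1 / (unpair e).2.+1], and the
    parametrization is Lipschitz with constant [3/2] when [r <= 1], so twice that
    many steps per side suffice. *)
Definition net_mesh (e : nat) : nat := 2 * (unpair e).2.+1.

Definition net_bound (e : nat) : nat :=
  (npair (npair (net_mesh e) (net_mesh e)) (net_mesh e).-1).+1.

Section Constructive.
Local Open Scope ring_scope.
Local Open Scope classical_set_scope.
Variable R : realType.

Lemma finite_isolated (X : metricType R) (N : set X) :
  finite_set N -> N `<=` isolated N.
Proof.
move=> finN x Nx; split; first exact: mem_set.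
exists (~` (N `\ x)).
  apply: open_nbhs_nbhs; split; last by case=> _ [].
  rewrite openC.
  have /accessible_finite_set_closed :=
    hausdorff_accessible (@metric_hausdorff R X).
  by apply; exact: finite_setD.
apply/seteqP; split => [y [ny Ny]|y ->]; last by split => // -[_ []].
by apply: contrapT => yx; apply: ny.
Qed.

Lemma grid_dense n (t : R) : (0 < n)%N -> 0 <= t <= 1 ->
  exists2 k, (k <= n)%N & `|t - grid R n k| <= n%:R^-1.
Proof.
move=> n0 /andP[t0 t1]; have nR : 0 < n%:R :> R by rewrite ltr0n.
have tn0 : 0 <= t * n%:R by rewrite mulr_ge0 // ltW.
have /andP[k1 k2] := truncn_itv tn0; set k := Num.truncn _ in k1 k2.
have kn : (k <= n)%N.
  by rewrite -(ler_nat R); apply: le_trans k1 _; rewrite ler_piMl // ltW.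
exists k => //; rewrite grid_id // -[t in t - _](mulfK (lt0r_neq0 nR)).
rewrite -mulrBl normrM.
rewrite [`|_^-1|]ger0_norm ?invr_ge0 ?(ltW nR) // ler_piMl ?invr_ge0 ?(ltW nR) //.
by rewrite ger0_norm ?subr_ge0 //; move: k2; rewrite -natr1; lra.
Qed.

(** The net is the same for all radii up to [1], and hence is computable without
    knowing the radius. *)
Lemma net_bubble (r : R) e : 0 <= r <= 1 -> 0 < decode_rat e ->
  eps_net (ratr (decode_rat e))
    ((fun i => bubble_pt r (name_pt R i)) @` [set` names_below (net_bound e)]).
Proof.
move=> /andP[r0 r1] e0.
have {e0} ep : 0 < ratr (decode_rat e) :> R by rewrite ltr0q.
split; first by apply: finite_isolated; apply: finite_image; exact: finite_seq.
move=> x; have [s [s1 s2 ->]] := bubble_pt_ind x.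
have n0 : (0 < net_mesh e)%N by rewrite /net_mesh; lia.
have [k kn sk] := grid_dense n0 s1; have [l ln sl] := grid_dense n0 s2.
pose i := npair (npair k l) (net_mesh e).-1.
have iE : name_pt R i = (grid R (net_mesh e) k, grid R (net_mesh e) l).
  by rewrite /name_pt /name_den /i !npairK; congr (grid R _ _, grid R _ _);
    exact: prednK.
exists (bubble_pt r (name_pt R i)).
  have im : i \in names_below (net_bound e).
    by rewrite mem_names_below ltnS !leq_npair.
  by exists i.
rewrite iE; apply: le_lt_trans (@bubble_lipschitz R r s (_, _) _ r0 sk sl) _.
move: ep; rewrite ratr_decode => ep.
have a1 : 1 <= (unpair e).1%:R :> R.
  by rewrite ler1n lt0n; apply: contraTneq ep => ->; rewrite mul0r ltxx.
have nR : 0 < (net_mesh e)%:R^-1 :> R by rewrite invr_gt0 ltr0n.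
apply: (@le_lt_trans _ _ (3 / 2 * (net_mesh e)%:R^-1)).
  by rewrite ler_piMl //; lra.
have bV : 0 < (unpair e).2.+1%:R^-1 :> R by rewrite invr_gt0 ltr0n.
apply: (@lt_le_trans _ _ (unpair e).2.+1%:R^-1); last by rewrite ler_peMl // ltW.
rewrite /net_mesh natrM invfM; move: (_.+1%:R^-1) bV => B bV.
lra.
Qed.

Lemma bubble_constructive (h : pred nat) (dist net : program) :
  (forall i j e, computes dist (npair (npair i j) e) (approx_dist h i j e)) ->
  (forall e, computes net e (code_seq (names_below (net_bound e)))) ->
  constructive_compact (fun i => bubble_pt (halt_radius R h) (name_pt R i))
    dist net.
Proof.
move=> distE netE; have /andP[r0 r1] := halt_radius_itv R h; split.
- exact: compact_bubble_space.
- by move=> i j e e0; exists (approx_dist h i j e) => //; exact: approx_distP.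
- move=> e e0; exists (names_below (net_bound e)) => //.
  by apply: net_bubble; rewrite ?r0.
Qed.
End Constructive.

(** * Programs for distances and nets *)

Lemma computable_sqr f : computable f -> computable (fun x => f x ^ 2).
Proof.
by move=> cf; apply: eq_computable (computable_muln cf cf) => x; rewrite mulnn.
Qed.

Lemma computable_if_eqn f k a b : computable f -> computable k ->
  computable a -> computable b ->
  computable (fun x => if f x == k x then a x else b x).
Proof.
move=> cf ck ca cb.
have cb2 : computable2 (fun x _ => b x).
  by apply: (computable_comp cb); auto with computable.
have cd : computable (fun x => (f x - k x) + (k x - f x)) by auto with computable.
apply: eq_computable (computable_case ca cb2 cd) => x.
rewrite eqn_leq -!subn_eq0; case: (f x - k x) => //=.
by case: (k x - f x).
Qed.

#[local] Hint Resolve computable_sqr : computable.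

Lemma computable_dist_num i j : computable i -> computable j ->
  computable (fun w => dist_num (i w) (j w)).
Proof.
move=> ci cj; rewrite /dist_num.
have cu k : computable k -> computable (fun w => name_inr (k w)) by
  move=> ck; rewrite /name_inr /name_x /name_y /name_den; auto 15 with computable.
have cx k : computable k -> computable (fun w => name_x (k w)) by
  move=> ck; rewrite /name_x /name_den; auto 15 with computable.
have cy k : computable k -> computable (fun w => name_y (k w)) by
  move=> ck; rewrite /name_y /name_den; auto 15 with computable.
have cd k : computable k -> computable (fun w => name_den (k w)) by
  move=> ck; rewrite /name_den; auto 15 with computable.
have cross f : (forall k, computable k -> computable (fun w => f (k w))) ->
    computable (fun w => cross_diff f (i w) (j w)).
  by move=> cf; rewrite /cross_diff /adiff; auto 10 with computable.
do !apply: computable_maxn.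
- by apply: (cross (fun k => name_inr k * name_den k)) => k ck;
  apply: computable_muln; auto.
- by apply: (cross (fun k => name_inr k * name_x k)) => k ck;
  apply: computable_muln; auto.
- by apply: (cross (fun k => name_inr k * name_y k)) => k ck;
  apply: computable_muln; auto.
Qed.

Lemma computable_dist_den i j : computable i -> computable j ->
  computable (fun w => dist_den (i w) (j w)).
Proof.
by move=> ci cj; rewrite /dist_den /name_den; auto 10 with computable.
Qed.

Lemma computable_approx_dist (h : nat -> pred nat) x i j e :
  computable2 (fun x n => if h x n then 1 else 2) ->
  computable x -> computable i -> computable j -> computable e ->
  computable (fun w => approx_dist (h (x w)) (i w) (j w) (e w)).
Proof.
move=> ch cx ci cj ce; rewrite /approx_dist.
have cs : computable (fun w =>
    search (fun n => if h (x w) n then 1 else 2) (2 * (unpair (e w)).2.+1)).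
  apply: (@computable_search (fun w n => if h (x w) n then 1 else 2)).
    apply: (computable_app2 ch); last by auto with computable.
    by apply: (computable_comp cx); auto with computable.
  by auto with computable.
apply: (@computable_case _ (fun w n =>
  npair (dist_num (i w) (j w)) (n.+1 * dist_den (i w) (j w)).-1)) cs.
  by auto with computable.
have ci1 : computable (fun w => i (unpair w).1).
  by apply: (computable_comp ci); auto with computable.
have cj1 : computable (fun w => j (unpair w).1).
  by apply: (computable_comp cj); auto with computable.
have := computable_dist_num ci1 cj1; have := computable_dist_den ci1 cj1.
by move=> c1 c2; red; auto 8 with computable.
Qed.

Lemma computable_names_code :
  computable (fun e => code_seq (names_below (net_bound e))).
Proof.
have cn : computable net_bound.
  by rewrite /net_bound /net_mesh; auto 12 with computable.
have cS : computable3 (fun _ n c => (npair n c).+1).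
  by red; auto 12 with computable.
apply: eq_computable (computable_nat_rect (computable_const 0) cS cn) => e.
by elim: (net_bound e) => //= n ->.
Qed.

(** * Self-reference *)

(** The program [p] with its first argument fixed to [x]. *)
Definition specialize (p : program) (x : nat) : program :=
  Comp p (Pair (const_prog x) id_prog).

Lemma computes_specialize p x y z :
  computes p (npair x y) z -> computes (specialize p x) y z.
Proof.
move=> pz; exists (npair x y) => //; exists x, y; split => //.
  exact: computes_const.
exact: computes_id.
Qed.

(** The code of [specialize p x] depends primitive recursively on the code of [p]
    and on [x]; the case where [x] is the code of [p] yields programs that
    can refer to their own code. *)
Lemma computable_godel_specialize :
  exists2 f, computable f &
    forall p, f (godel p) = godel (specialize p (godel p)).
Proof.
have cS : computable3 (fun _ _ c => npair 5 (npair (npair 1 0) c)).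
  by red; auto 12 with computable.
have cc : computable (fun x => godel (const_prog x)).
  have c0 := computable_const (npair 0 0).
  apply: eq_computable (computable_nat_rect c0 cS computable_id) => x.
  by elim: x => //= x ->.
(* The constructor numbers [5] and [4] are those of [Comp] and [Pair]. *)
exists (fun x => npair 5 (npair x
  (npair 4 (npair (godel (const_prog x)) (godel id_prog))))) => //.
by auto 12 with computable.
Qed.

Theorem theorem1 (R : realType) :
  ~ exists D : program,
      forall (X : metricType R) (pt : nat -> X) (dist net : program) (b : nat),
        constructive_compact pt dist net ->
        let input := npair (npair (godel dist) (godel net)) b in
        (pi2_trivial R (pt b) -> computes D input 1) /\
        (~ pi2_trivial R (pt b) -> computes D input 0).
Proof.
move=> [D DP].
have [net netE] := computable_names_code.
have [self cself selfE] := computable_godel_specialize.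
pose b := npair (npair 0 0) 0.
pose input x := npair (npair (self x) (godel net)) b.
(* [input x] describes the space whose distances are computed by the program of
   code [x], applied to [x] itself. *)
pose says_trivial x n := fuel_eval D n (input x) == 2.
have csays : computable2 (fun x n => if says_trivial x n then 1 else 2).
  apply: computable_if_eqn; try by auto with computable.
  have cself1 : computable (fun w => self (unpair w).1).
    by apply: (computable_comp cself); auto with computable.
  apply: (computable_app2 (@computable_fuel_eval D));
    first by auto with computable.
  by rewrite /input; auto 12 with computable.
(* [E] computes the distances of the space that collapses iff [D] never calls
   the space described by [input x] trivial; [x] will be the code of [E]. *)
have [E EP] : computable (fun w => approx_dist (says_trivial (unpair w).1)
   (unpair (unpair (unpair w).2).1).1 (unpair (unpair (unpair w).2).1).2
     (unpair (unpair w).2).2).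
  by apply: computable_approx_dist; auto with computable.
pose dist := specialize E (godel E).
pose h := says_trivial (godel E).
have distE i j e : computes dist (npair (npair i j) e) (approx_dist h i j e).
  apply: computes_specialize.
  by have := EP (npair (godel E) (npair (npair i j) e)); rewrite !npairK.
have [] := DP _ _ _ _ b (bubble_constructive R distE netE).
rewrite -[godel dist]selfE -/(input _).
have -> : name_pt R b = (0, 0)%R by rewrite /name_pt /b !npairK /= grid0.
move=> Dtriv Dnontriv.
(* If [D] answers that the space is trivial, then it is a sphere, and [D] must
   also give the other answer; otherwise it is a point, and [D] must answer. *)
have [[n hn]|noh] := pselect (exists n, h n).
  have /fuel_eval_complete[m Dm] := Dnontriv (pi2_sphere_nontrivial
    (halt_radius_gt0 R hn)).
  have Dn : fuel_eval D n (input (godel E)) = 2 by apply/eqP.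
  have := fuel_eval_mono (leq_maxl n m) Dn.
  by rewrite (fuel_eval_mono (leq_maxr n m) Dm).
have r0 : halt_radius R h = 0%R.
  by apply: halt_radius_eq0 => n; apply/negP => hn; apply: noh; exists n.
have /fuel_eval_complete[n Dn] : computes D (input (godel E)) 1.
  apply: Dtriv; apply: pi2_point_trivial => x; have [s [_ _ ->]] :=
    bubble_pt_ind x.
  by rewrite r0; apply: val_inj; rewrite /= /bubble_map /scale3 !mul0r.
by apply: noh; exists n; apply/eqP.
Qed.
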